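(* Let $n\geq 3$ and let $F(x,y)$ be a binary form of degree $n$ with rational integer coefficients such that $f(x)=F(x,1)$ has leading coefficient $1$ and $n$ distinct real roots $\alpha_1,\ldots,\alpha_n$. Let $0<\varepsilon<1$ and $K\geq 1$, and put \[ A=\min_{i\neq j}|\alpha_i-\alpha_j|,\quad B=\min_i\prod_{j\neq i}|\alpha_j-\alpha_i|,\quad C=\frac{K}{(1-\varepsilon)^{n-1}B},\quad G=\frac{K^{1/n}}{\varepsilon A}. \] Let $m\geq 1$ be a square-free integer, $M=\mathbb{Q}(i\sqrt{m})$, and $\mathbb{Z}_M$ its ring of integers. If $m\equiv 3 \pmod 4$, set $s=2$ and write $x,y\in\mathbb{Z}_M$ as $x=x_1+x_2\frac{1+i\sqrt{m}}{2}$, $y=y_1+y_2\frac{1+i\sqrt{m}}{2}$; if $m\equiv 1,2\pmod 4$, set $s=1$ and write $x=x_1+x_2 i\sqrt{m}$, $y=y_1+y_2 i\sqrt{m}$; in both cases $x_1,x_2,y_1,y_2\in\mathbb{Z}$. ($F$ is not assumed irreducible.) Let $(x,y)\in\mathbb{Z}_M^2$ satisfy $|F(x,y)|\leq K$, where $|\cdot|$ is the complex absolute value. Then: \begin{enumerate} \item $|F(sx_1+(s-1)x_2,\, sy_1+(s-1)y_2)|\leq s^nK$ and $|F(x_2,y_2)|\leq \dfrac{s^nK}{(\sqrt{m})^n}$; \item $|F(sx_1+(s-1)x_2,\, sy_1+(s-1)y_2)|\cdot|F(x_2,y_2)|\leq \dfrac{s^{2n}K^2}{2^n(\sqrt{m})^n}$;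 \item if $|y|>\max\left\{G,\left(\frac{sC}{\sqrt{m}}\right)^{\frac{1}{n-2}}\right\}$, then $x_2y_1=x_1y_2$; \item if $|y|>\max\left\{G,(sC)^{\frac{1}{n-1}}\right\}$ and $sy_1+(s-1)y_2=0$, then $sx_1+(s-1)x_2=0$; \item if $|y|>\max\left\{G,\left(\frac{sC}{\sqrt{m}}\right)^{\frac{1}{n-1}}\right\}$ and $y_2=0$, then $x_2=0$. \end{enumerate}
   Context: $\mathbb{Z}_M$ denotes the ring of integers of the imaginary quadratic field $M=\mathbb{Q}(i\sqrt{m})$; for $m\equiv 3\pmod 4$ it has $\mathbb{Z}$-basis $1,\frac{1+i\sqrt{m}}{2}$, and for $m\equiv 1,2\pmod 4$ it has $\mathbb{Z}$-basis $1, i\sqrt{m}$. The form $F$ is evaluated at complex arguments in the obvious way, and $|y|$ denotes the complex absolute value of $y$. *)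

(* Defs.v *)
From HB Require Import structures.
From mathcomp Require Import all_boot all_order all_algebra.
From mathcomp Require Import complex.
From mathcomp Require Import mpoly.
From mathcomp Require Import classical_sets reals exp.

Set Implicit Arguments.
Unset Strict Implicit.
Unset Printing Implicit Defensive.

Import Order.TTheory GRing.Theory Num.Theory.
Local Open Scope ring_scope.
Local Open Scope complex_scope.

(* The first indeterminate is the one of index 0.  Taking S := {poly int},    *)
(* x := 'X and y := 1 gives the polynomial F(X, 1).                           *)
Definition form_eval (S : comNzRingType) (F : {mpoly int[2]}) (x y : S) : S :=
  mmap intr (fun i : 'I_2 => if i == ord0 then x else y) F.

Definition square_free (m : nat) : Prop :=
  forall d : nat, (d ^ 2 %| m)%N -> d = 1%N.

Definition is_min (R : realType) (E : set R) (a : R) : Prop :=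
  E a /\ lbound E a.

Definition i_sqrt (R : realType) (m : nat) : R[i] :=
  'i%C * (Num.sqrt (m%:R : R))%:C.

Definition in_quadratic_field (R : realType) (m : nat) (z : R[i]) : Prop :=
  exists a b : rat, z = ratr a + ratr b * i_sqrt R m.

Definition in_ring_of_integers (R : realType) (m : nat) (z : R[i]) : Prop :=
  in_quadratic_field m z /\ integralOver (intr : int -> R[i]) z.

(* (1, omega R m) is a Z-basis of the ring of integers of Q(i sqrt m) when m  *)
(* is square-free.                                                            *)
Definition omega (R : realType) (m : nat) : R[i] :=
  if (m %% 4 == 3)%N then (1 + i_sqrt R m) / 2%:R else i_sqrt R m.

Definition s_of (m : nat) : nat := if (m %% 4 == 3)%N then 2 else 1.

(* Main.v *)
Require Import Defs.
From mathcomp Require Import all_boot all_order all_algebra.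
From mathcomp Require Import complex.
From mathcomp Require Import mpoly.
From mathcomp Require Import classical_sets reals exp.
From mathcomp Require Import zify ring lra.

Set Implicit Arguments.
Unset Strict Implicit.
Unset Printing Implicit Defensive.

Import Order.TTheory GRing.Theory Num.Theory.
Local Open Scope ring_scope.
Local Open Scope complex_scope.

(** Over any field containing the roots, [F(x, y)] is the product of the
    [x - alpha_i y].  With [X = s x1 + (s - 1) x2] and [Y] likewise, one has
    [s (x - alpha_i y) = (X - alpha_i Y) + i sqrt m (x2 - alpha_i y2)], so
    [|X - alpha_i Y|] and [sqrt m |x2 - alpha_i y2|] are at most
    [s |x - alpha_i y|], and twice their product is at most its square;
    multiplying over [i] gives parts 1 and 2.

    If [|y| > G], some factor [x - alpha_j y] has modulus at most
    [K ^ (1/n) < eps A |y|], hence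
    [|x - alpha_i y| > (1 - eps) |alpha_i - alpha_j| |y|] for the others, and
    [|x - alpha_j y| <= C / |y| ^ (n - 1)].  Parts 4 and 5 follow by taking the
    real and the imaginary part of [s (x - alpha_j y)].  For part 3,
    [s sqrt m (x2 y1 - x1 y2)] is the imaginary part of
    [s (x - alpha_j y)] times the conjugate of [s y].  In each case an integer
    has absolute value less than 1. *)

(** * Evaluation of an integral form and its factorization into linear forms *)

Lemma form_evalE (S : comNzRingType) (F : {mpoly int[2]}) (x y : S) :
  form_eval F x y =
  \sum_(k <- msupp F) (F@_k)%:~R * (x ^+ k ord0 * y ^+ k (lift ord0 ord0)).
Proof.
by apply: eq_bigr => k _; rewrite /mmap1 big_ord_recl big_ord1.
Qed.

Lemma rmorph_form_eval (S T : comNzRingType) (phi : {rmorphism S -> T})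
    (F : {mpoly int[2]}) (x y : S) :
  phi (form_eval F x y) = form_eval F (phi x) (phi y).
Proof.
rewrite !form_evalE rmorph_sum; apply: eq_bigr => k _.
by rewrite !rmorphM rmorph_int !rmorphXn.
Qed.

(** Both changing the coefficients and evaluating at [t] are ring morphisms, and these commute with
    [form_eval]. *)
Lemma horner_form_eval (S : comNzRingType) (F : {mpoly int[2]}) (t : S) :
  (map_poly intr (form_eval F 'X 1)).[t] = form_eval F t 1.
Proof.
rewrite (rmorph_form_eval (map_poly intr)) rmorph1 /= map_polyX.
by rewrite -/(horner_eval t _) rmorph_form_eval rmorph1 /= horner_evalE hornerX.
Qed.

Section BinaryForm.

Variables (F : {mpoly int[2]}) (n : nat).
Hypothesis hF : F \is n.-homog.

Lemma binary_mdeg k : k \in msupp F -> (k ord0 + k (lift ord0 ord0))%N = n.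
Proof.
move/dhomogP: hF => /[apply] /= <-.
by rewrite mdegE big_ord_recl big_ord1.
Qed.

Lemma coef_form_eval i :
  (form_eval F ('X : {poly int}) 1)`_i
  = \sum_(k <- msupp F) F@_k * (i == k ord0)%:R.
Proof.
rewrite form_evalE coef_sum; apply: eq_bigr => k _.
by rewrite expr1n mulr1 mulrzl coefMrz coefXn -mulrzl intz.
Qed.

Lemma size_form_eval : (size (form_eval F ('X : {poly int}) 1) <= n.+1)%N.
Proof.
apply/leq_sizeP => i ni; rewrite coef_form_eval big1_seq // => k /= /binary_mdeg kn.
by case: eqP => [ik|]; rewrite ?mulr0 //; move: ni; rewrite ik -kn ltnNge leq_addr.
Qed.

Lemma form_eval_homog (S : comNzRingType) (c u v : S) :
  form_eval F (c * u) (c * v) = c ^+ n * form_eval F u v.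
Proof.
rewrite !form_evalE mulr_sumr; apply: eq_big_seq => k /binary_mdeg <-.
by rewrite !exprMn exprD; ring.
Qed.

(** Only the monomial free of the second variable survives. This is the point at infinity, which
    dehomogenization by [v] misses. *)
Lemma form_eval_infinity (S : comNzRingType) (u : S) :
  form_eval F u 0 = ((form_eval F ('X : {poly int}) 1)`_n)%:~R * u ^+ n.
Proof.
rewrite form_evalE coef_form_eval rmorph_sum mulr_suml.
apply: eq_big_seq => k /binary_mdeg kn.
rewrite -kn -[X in _ == X]addn0 eqn_add2l rmorphM expr0n /=.
case: eqP => [->|]; last by rewrite !(mulr0, mul0r).
by rewrite addn0; ring.
Qed.

Variables (K : fieldType) (alpha : 'I_n -> K).
Hypothesis hlead : lead_coef (form_eval F ('X : {poly int}) 1) = 1.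
Hypothesis alpha_inj : injective alpha.
Hypothesis alpha_root : forall i,
  root (map_poly intr (form_eval F ('X : {poly int}) 1)) (alpha i).

Let f : {poly int} := form_eval F 'X 1.

Lemma lead_coef_map_form_eval : lead_coef (map_poly intr f : {poly K}) = 1.
Proof. by rewrite lead_coef_map_eq hlead ?rmorph1 ?oner_neq0. Qed.

(** Homogeneity bounds the degree by [n] from above, the [n] distinct roots bound it from below. The
    leading coefficient 1 keeps the image in [K] nonzero. *)
Lemma size_map_form_eval : size f = n.+1 /\ size (map_poly intr f : {poly K}) = n.+1.
Proof.
have f1 : map_poly intr f != 0 :> {poly K}.
  by rewrite -lead_coef_eq0 lead_coef_map_form_eval oner_neq0.
have : (size [seq alpha i | i <- enum 'I_n] < size (map_poly intr f : {poly K}))%N.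
  apply: max_poly_roots => //; first by apply/allP => _ /mapP[i _ ->].
  by rewrite map_inj_uniq ?enum_uniq.
rewrite size_map -cardE card_ord => nf.
have fm : (size (map_poly intr f : {poly K}) <= size f)%N by apply: size_poly.
have := size_form_eval; rewrite -/f => fn.
by split; apply/eqP; rewrite eqn_leq ?fn ?nf ?(leq_trans nf fm) ?(leq_trans fm fn).
Qed.

Lemma map_form_eval_prod :
  map_poly intr f = \prod_(i < n) ('X - (alpha i)%:P) :> {poly K}.
Proof.
have := @all_roots_prod_XsubC _ (map_poly intr f) [seq alpha i | i <- enum 'I_n].
rewrite size_map -cardE card_ord size_map_form_eval.2 lead_coef_map_form_eval scale1r.
rewrite uniq_rootsE map_inj_uniq ?enum_uniq // big_map big_enum; apply => //.
by apply/allP => _ /mapP[i _ ->].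
Qed.

(** For nonzero [v], homogeneity reduces to the factorization of [f] at [u / v]. The morphism [phi]
    lets the real roots serve both over the reals and inside [R[i]]. *)
Lemma form_eval_prod (L : fieldType) (phi : {rmorphism K -> L}) (u v : L) :
  form_eval F u v = \prod_(i < n) (u - phi (alpha i) * v).
Proof.
have [->|v0] := eqVneq v 0.
  have fn : f`_n = 1 by rewrite -hlead lead_coefE size_map_form_eval.1.
  rewrite form_eval_infinity fn mul1r.
  under eq_bigr do rewrite mulr0 subr0.
  by rewrite prodr_const card_ord.
have -> : form_eval F u v = v ^+ n * form_eval F (u / v) 1.
  by rewrite -form_eval_homog mulr1 mulrC divfK.
have -> : form_eval F (u / v) 1 = \prod_(i < n) (u / v - phi (alpha i)).
  rewrite -horner_form_eval.
  have -> : map_poly intr f = map_poly phi (map_poly intr f) :> {poly L}.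
    by rewrite -map_poly_comp; apply: eq_map_poly => z /=; rewrite rmorph_int.
  rewrite map_form_eval_prod rmorph_prod horner_prod; apply: eq_bigr => i _.
  by rewrite rmorphB /= map_polyX map_polyC hornerXsubC.
rewrite -{1}(card_ord n) -prodr_const -big_split /=; apply: eq_bigr => i _.
by rewrite mulrBr mulrCA divff // mulr1 mulrC.
Qed.

End BinaryForm.

(** * Real estimates: gaps between the roots and the factor of least size *)

Section Analytic.
Variable R : realType.

Lemma powRV_lt_exprn (a r : R) (k : nat) :
  (0 < k)%N -> 0 <= a -> powR a (k%:R^-1) < r -> a < r ^+ k.
Proof.
move=> k0 a0 ar.
rewrite -{1}(powRr1 a0) -(@mulVf _ k%:R) ?pnatr_eq0 -?lt0n //.
by rewrite powRrM powR_mulrn ?powR_ge0 // ltrXn2r ?powR_ge0 -?lt0n.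
Qed.

Variables (n : nat) (alpha : 'I_n -> R) (eps K A B : R).
Hypothesis n_gt0 : (0 < n)%N.
Hypothesis alpha_inj : injective alpha.
Hypothesis heps : 0 < eps < 1.
Hypothesis K_gt0 : 0 < K.
Hypothesis hA : is_min [set d : R | exists i j : 'I_n,
                  i <> j /\ d = `|alpha i - alpha j|]%classic A.
Hypothesis hB : is_min [set d : R | exists i : 'I_n,
                  d = \prod_(j < n | j != i) `|alpha j - alpha i|]%classic B.

Lemma min_gap_gt0 : 0 < A.
Proof.
case: hA => -[i [j [ij ->]]] _; rewrite normr_gt0 subr_eq0.
by apply/eqP => /alpha_inj.
Qed.

Lemma min_gap_prod_gt0 : 0 < B.
Proof.
case: hB => -[i ->] _; apply: prodr_gt0 => j ji.
by rewrite normr_gt0 subr_eq0 (inj_eq alpha_inj).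
Qed.

(** Here [b i] stands for the modulus of [x - alpha_i y] and [r] for that of [y]. The third premise
    is what the triangle inequality gives for two factors, so no complex number enters. *)
Lemma close_to_root (r : R) (b : 'I_n -> R) :
  (forall i, 0 <= b i) -> \prod_i b i <= K ->
  (forall i j, `|alpha i - alpha j| * r <= b i + b j) ->
  powR K (n%:R^-1) / (eps * A) < r ->
  exists j, b j <= K / ((1 - eps) ^+ (n - 1) * B) / r ^+ (n - 1).
Proof.
move=> b0 bK br Gr; case/andP: heps => e0 e1.
have A0 := min_gap_gt0; have B0 := min_gap_prod_gt0.
set k := powR K _ in Gr.
have kK : k ^+ n = K.
  by rewrite -powR_mulrn ?powR_ge0 // -powRrM mulVf ?pnatr_eq0 -?lt0n // powRr1 // ltW.
have k0 : 0 < k by apply: powR_gt0.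
have r0 : 0 < r by apply: lt_trans Gr; rewrite divr_gt0 // mulr_gt0.
have kr : k < eps * A * r by rewrite mulrC -ltr_pdivrMr // mulr_gt0.
(* Were all [n] factors larger than [k], their product would exceed [k ^+ n = K]. The strict
   inequality of products needs an index, hence [n_gt0]. *)
have [j bj] : exists j, b j <= k.
  apply/existsP; apply: contraTT bK; rewrite negb_exists => /forallP kb.
  rewrite -ltNge -kK -{1}(card_ord n) -prodr_const.
  apply: ltr_prod => [|i _].
    by apply/hasP; exists (Ordinal n_gt0); rewrite ?mem_index_enum.
  by rewrite ltW //= ltNge kb.
exists j.
(* Since [b j <= k < eps * A * r] and [A] is the least gap, [b j] takes away at most the fraction
   [eps] of the gap times [r]. *)
have far i : i != j -> (1 - eps) * r * `|alpha i - alpha j| <= b i.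
  move=> ij; have Aij : A <= `|alpha i - alpha j|.
    by apply: hA.2; exists i, j; split => //; apply/eqP.
  have eA : eps * r * A <= eps * r * `|alpha i - alpha j|.
    by rewrite ler_pM2l // mulr_gt0.
  have := br i j; nra.
have prod_far : ((1 - eps) * r) ^+ (n - 1) * B <= \prod_(i | i != j) b i.
  have <- : #|[pred i | i != j]| = (n - 1)%N.
    by have := cardC1 j; rewrite card_ord subn1 => <-; apply: eq_card => i; rewrite !inE.
  apply: (@le_trans _ _ (\prod_(i | i != j) ((1 - eps) * r * `|alpha i - alpha j|))).
    rewrite big_split /= prodr_const ler_pM2l ?exprn_gt0 ?mulr_gt0 ?subr_gt0 //.
    by apply: hB.2; exists j.
  apply: ler_prod => i /far ->; rewrite andbT.
  by rewrite !mulr_ge0 // ltW // subr_gt0.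
rewrite -mulrA -invfM ler_pdivlMr; last first.
  by rewrite !mulr_gt0 ?exprn_gt0 ?subr_gt0.
apply: le_trans bK; rewrite (bigD1 j) //=; apply: ler_wpM2l => //.
by apply: le_trans prod_far; rewrite exprMn mulrAC.
Qed.

End Analytic.

Lemma intr_norm_lt1 (R : realType) (z : int) : `|z%:~R : R| < 1 -> z = 0.
Proof. by rewrite -intr_norm (@ltr_int R _ 1); lia. Qed.

(** Lagrange's identity: the difference of the two sides is a square. It bounds the imaginary part
    of [p + iq] times the conjugate of [u + iv]. *)
Lemma sqr_cross_le (R : realDomainType) (p q u v : R) :
  (q * u - p * v) ^+ 2 <= (p ^+ 2 + q ^+ 2) * (u ^+ 2 + v ^+ 2).
Proof.
rewrite -subr_ge0 (_ : _ - _ = (p * u + q * v) ^+ 2) ?sqr_ge0 //; ring.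
Qed.

(** * Complex moduli as real numbers, and coordinates of quadratic integers *)

Section Complex.
Variable R : realType.
Implicit Types (z w : R[i]) (a : R).

(** The norm of [R[i]] takes its values in [R[i]]; [complex.Re] brings it down to [R] without loss,
    and all estimates are made there. *)
Lemma Re_normK z : (complex.Re `|z|)%:C = `|z|.
Proof. by rewrite RRe_real ?normr_real. Qed.

Lemma Re_norm_ge0 z : 0 <= complex.Re `|z|.
Proof. by rewrite -lecR Re_normK normr_ge0. Qed.

Lemma sqr_Re_norm z : complex.Re `|z| ^+ 2 = complex.Re z ^+ 2 + complex.Im z ^+ 2.
Proof. by rewrite normc_def sqr_sqrtr // addr_ge0 ?sqr_ge0. Qed.

Lemma Re_normM z w : complex.Re `|z * w| = complex.Re `|z| * complex.Re `|w|.
Proof. by apply: (@complexI R); rewrite rmorphM /= !Re_normK normrM. Qed.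

Lemma Re_norm_real a : complex.Re `|a%:C| = `|a|.
Proof. by rewrite normc_def /= expr0n addr0 sqrtr_sqr. Qed.

Lemma ler_Re_normB z w : complex.Re `|z - w| <= complex.Re `|z| + complex.Re `|w|.
Proof. by rewrite -lecR rmorphD /= !Re_normK ler_normB. Qed.

Lemma Re_norm_prod (I : finType) (h : I -> R[i]) :
  complex.Re `|\prod_i h i| = \prod_i complex.Re `|h i|.
Proof.
apply: (@complexI R); rewrite rmorph_prod /= Re_normK normr_prod.
by apply: eq_bigr => i _; rewrite /= Re_normK.
Qed.

(** The factor [s] clears the denominator 2 of [omega], so in both cases the real part is an integer
    and the imaginary part an integer times the root of [m]. *)
Lemma scale_quadratic_integer (m : nat) (k l : int) :
  let s := s_of m in
  s%:R * (k%:~R + l%:~R * omega R m)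
  = (s%:Z * k + (s%:Z - 1) * l)%:~R +i* (Num.sqrt m%:R * l%:~R).
Proof.
have iE : i_sqrt R m = 0 +i* Num.sqrt m%:R.
  by rewrite /i_sqrt; simpc.
have intE (j : int) : j%:~R = (j%:~R : R)%:C by rewrite rmorph_int.
rewrite /s_of /omega; case: ifP => _ /=.
  have -> : 2 * (k%:~R + l%:~R * ((1 + i_sqrt R m) / 2))
     = (2 * k + l)%:~R + l%:~R * i_sqrt R m.
    by rewrite rmorphD rmorphM /=; field.
  have -> : (2 * k + (2 - 1) * l = 2 * k + l)%R by ring.
  by rewrite iE !intE; simpc; congr (_ +i* _); rewrite mulrC.
have -> : (1 * k + (1 - 1) * l = k)%R by ring.
by rewrite mul1r iE !intE; simpc; congr (_ +i* _); rewrite mulrC.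
Qed.

End Complex.

(** * The bounds for solutions in the ring of integers *)

Theorem theorem1 (R : realType) (n : nat) (hn : (3 <= n)%N)
  (F : {mpoly int[2]}) (hF : F \is n.-homog)
  (hlead : lead_coef (form_eval F ('X : {poly int}) 1) = 1)
  (alpha : 'I_n -> R) (halpha_inj : injective alpha)
  (halpha_root : forall i : 'I_n,
     root (map_poly intr (form_eval F ('X : {poly int}) 1)) (alpha i))
  (eps K : R) (heps : 0 < eps < 1) (hK : 1 <= K)
  (A B C G : R)
  (hA : is_min [set d : R | exists i j : 'I_n,
                  i <> j /\ d = `|alpha i - alpha j|]%classic A)
  (hB : is_min [set d : R | exists i : 'I_n,
                  d = \prod_(j < n | j != i) `|alpha j - alpha i|]%classic B)
  (hC : C = K / ((1 - eps) ^+ (n - 1) * B))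
  (hG : G = powR K (n%:R^-1) / (eps * A))
  (m : nat) (hm : (1 <= m)%N) (hm_sqf : square_free m)
  (x y : R[i])
  (hx : in_ring_of_integers m x) (hy : in_ring_of_integers m y)
  (x1 x2 y1 y2 : int)
  (hx12 : x = x1%:~R + x2%:~R * omega R m)
  (hy12 : y = y1%:~R + y2%:~R * omega R m)
  (hFxy : `|form_eval F x y| <= K%:C) :
  let s : nat := s_of m in
  let sqm : R := Num.sqrt m%:R in
  let X : int := s%:Z * x1 + (s%:Z - 1) * x2 in
  let Y : int := s%:Z * y1 + (s%:Z - 1) * y2 in
  let FXY : R := `|form_eval F X Y|%:~R in
  let Fx2y2 : R := `|form_eval F x2 y2|%:~R in
  [/\ FXY <= s%:R ^+ n * K /\ Fx2y2 <= s%:R ^+ n * K / sqm ^+ n,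
      FXY * Fx2y2 <= s%:R ^+ (2 * n) * K ^+ 2 / (2%:R ^+ n * sqm ^+ n),
      (Num.max G (powR (s%:R * C / sqm) ((n - 2)%:R^-1)))%:C < `|y| ->
        x2 * y1 = x1 * y2,
      (Num.max G (powR (s%:R * C) ((n - 1)%:R^-1)))%:C < `|y| ->
        Y = 0 -> X = 0
    & (Num.max G (powR (s%:R * C / sqm) ((n - 1)%:R^-1)))%:C < `|y| ->
        y2 = 0 -> x2 = 0].
Proof.
move=> s sqm X Y FXY Fx2y2.
have sqm0 : 0 < sqm by rewrite sqrtr_gt0 ltr0n.
have s0 : 0 < s%:R :> R by rewrite ltr0n /s /s_of; case: ifP.
have K0 : 0 < K := lt_le_trans ltr01 hK.
have n0 : (0 < n)%N by apply: leq_trans hn.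
have n1 : (0 < n - 1)%N by rewrite subn_gt0 (leq_trans _ hn).
have n2 : (0 < n - 2)%N by rewrite subn_gt0.
pose r := complex.Re `|y|.
pose b i := complex.Re `|x - (alpha i)%:C * y|.
have r0 : 0 <= r := Re_norm_ge0 y.
have b0 i : 0 <= b i := Re_norm_ge0 _.
have bK : \prod_i b i <= K.
  rewrite -Re_norm_prod -(form_eval_prod hF hlead halpha_inj halpha_root).
  by rewrite -lecR Re_normK.
have FE (k l : int) : `|form_eval F k l|%:~R = \prod_i `|k%:~R - alpha i * l%:~R|.
  rewrite intr_norm rmorph_form_eval.
  rewrite (form_eval_prod hF hlead halpha_inj halpha_root idfun).
  by rewrite normr_prod.
have sx : s%:R * x = X%:~R +i* (sqm * x2%:~R).
  by rewrite hx12 scale_quadratic_integer.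
have sy : s%:R * y = Y%:~R +i* (sqm * y2%:~R).
  by rewrite hy12 scale_quadratic_integer.
have sE : complex.Re `|s%:R : R[i]| = s%:R.
  have -> : s%:R = (s%:R : R)%:C by rewrite rmorph_nat.
  by rewrite Re_norm_real normr_nat.
(* As [alpha i] is real, the two squares come from the real and imaginary parts of
   [s (x - alpha_i y)]. *)
have sb i : (s%:R * b i) ^+ 2 = (X%:~R - alpha i * Y%:~R) ^+ 2
                        + (sqm * (x2%:~R - alpha i * y2%:~R)) ^+ 2.
  rewrite -{1}sE -Re_normM mulrBr mulrCA sx sy sqr_Re_norm; simpc => /=.
  by congr (_ + _ ^+ 2); ring.
have sr : (s%:R * r) ^+ 2 = Y%:~R ^+ 2 + (sqm * y2%:~R) ^+ 2.
  by rewrite -{1}sE -Re_normM sy sqr_Re_norm.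
have sb0 i : 0 <= s%:R * b i by rewrite mulr_ge0 // ltW.
have Xb i : `|X%:~R - alpha i * Y%:~R| <= s%:R * b i.
  by rewrite -ler_sqr ?nnegrE // sb real_normK ?num_real // lerDl sqr_ge0.
have xb i : sqm * `|x2%:~R - alpha i * y2%:~R| <= s%:R * b i.
  rewrite -[sqm]gtr0_norm // -normrM.
  by rewrite -ler_sqr ?nnegrE // sb real_normK ?num_real // lerDr sqr_ge0.
have prod_sb : \prod_i (s%:R * b i) <= s%:R ^+ n * K.
  by rewrite big_split prodr_const card_ord ler_pM2l // exprn_gt0.
have approx : G < r -> exists j, b j <= C / r ^+ (n - 1).
  rewrite hG hC; apply: (close_to_root n0 halpha_inj heps K0 hA hB) => // i j.
  rewrite -Re_norm_real -Re_normM.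
  have -> : (alpha i - alpha j)%:C * y
    = (x - (alpha j)%:C * y) - (x - (alpha i)%:C * y) by rewrite rmorphB /=; ring.
  by rewrite (le_trans (ler_Re_normB _ _)) // addrC.
have C0 : 0 < C.
  rewrite hC divr_gt0 // mulr_gt0 ?(min_gap_prod_gt0 halpha_inj hB) // exprn_gt0 //.
  by case/andP: heps => _; rewrite subr_gt0.
have sC : 0 < s%:R * C by rewrite mulr_gt0.
have sCq : 0 < s%:R * C / sqm by rewrite divr_gt0.
have G0 : 0 <= G.
  have A0 := min_gap_gt0 halpha_inj hA; case/andP: heps => e0 _.
  by rewrite hG divr_ge0 ?powR_ge0 // mulr_ge0 // ltW.
have largeP (a : R) (k : nat) : (0 < k)%N -> 0 < a ->
    (Num.max G (powR a (k%:R^-1)))%:C < `|y| ->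
    [/\ 0 < r, G < r & a < r ^+ k].
  move=> k0 a0; rewrite -Re_normK ltcR gt_max => /andP[Gr ar].
  by split => //; [apply: le_lt_trans Gr|apply: powRV_lt_exprn => //; apply: ltW].
split.
- split.
    by rewrite /FXY FE (le_trans _ prod_sb) // ler_prod // => i _; rewrite normr_ge0 Xb.
  rewrite /Fx2y2 FE ler_pdivlMr ?exprn_gt0 // mulrC (le_trans _ prod_sb) //.
  rewrite -{1}(card_ord n) -prodr_const -big_split ler_prod // => i _.
  by rewrite mulr_ge0 ?xb // ltW.
(* Applied to each factor with [p = X - alpha_i Y] and [q = x2 - alpha_i y2], where [sb] makes the
   right side [(s b_i)^2]; the [n] constants [2 sqm] give the denominator. *)
- have AMGM p q : 2%:R * sqm * (`|p| * `|q|) <= p ^+ 2 + (sqm * q) ^+ 2.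
    rewrite exprMn -(real_normK (num_real p)) -(real_normK (num_real q)) -subr_ge0.
    by rewrite (_ : _ - _ = (`|p| - sqm * `|q|) ^+ 2) ?sqr_ge0 //; ring.
  rewrite ler_pdivlMr ?mulr_gt0 ?exprn_gt0 // /FXY /Fx2y2 !FE.
  rewrite mulrC -exprMn -{1}(card_ord n) -prodr_const -!big_split /=.
  rewrite mulnC exprM -exprMn.
  apply: (@le_trans _ _ (\prod_i (s%:R * b i) ^+ 2)).
    apply: ler_prod => i _; rewrite sb AMGM andbT.
    by rewrite !mulr_ge0 // ltW.
  by rewrite prodrXl ler_sqr ?nnegrE ?prodr_ge0 // ltW // mulr_gt0 // exprn_gt0.
- move=> /(largeP _ _ n2 sCq)[rp Gr Cr].
  have [j bj] := approx Gr.
  apply/eqP; rewrite -subr_eq0; apply/eqP/(@intr_norm_lt1 R).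
  set d := _%:~R.
  (* The terms in [alpha j] cancel, and so do the [x2 y2] terms coming from [s - 1]. The right side
     has the shape [q u - p v] for the parts of [s (x - alpha_j y)] and of [s y]. *)
  have dE : sqm * s%:R * d = sqm * (x2%:~R - alpha j * y2%:~R) * Y%:~R
                 - (X%:~R - alpha j * Y%:~R) * (sqm * y2%:~R).
    rewrite /d /X /Y !(rmorphB, rmorphD, rmorphM) /=; ring.
  (* Cauchy-Schwarz *)
  have CS : (sqm * s%:R * d) ^+ 2 <= ((s%:R * b j) * (s%:R * r)) ^+ 2.
    by rewrite [leRHS]exprMn sb sr dE sqr_cross_le.
  have {CS} : sqm * `|d| <= s%:R * (b j * r).
    rewrite -(ler_pM2l s0).
    have -> : s%:R * (sqm * `|d|) = `|sqm * s%:R * d|.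
      by rewrite !normrM (gtr0_norm sqm0) (gtr0_norm s0) mulrCA mulrA.
    have -> : s%:R * (s%:R * (b j * r)) = (s%:R * b j) * (s%:R * r) by ring.
    by rewrite -ler_sqr ?nnegrE ?mulr_ge0 ?(ltW s0) // real_normK ?num_real.
  have bjr : b j * r ^+ (n - 2) * r <= C.
    have -> : b j * r ^+ (n - 2) * r = b j * r ^+ (n - 1).
      by rewrite -mulrA -exprSr; congr (_ * _ ^+ _); rewrite -subSn // (leq_trans _ hn).
    by rewrite -ler_pdivlMr // exprn_gt0.
  have rn : 0 < r ^+ (n - 2) by rewrite exprn_gt0.
  move: Cr; rewrite ltr_pdivrMr // => Cr.
  (* If [|d|] were at least 1, then [sqm <= s b_j r <= s C / r ^+ (n - 2) < sqm]; one power of [r]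
     is lost to the factor [y], whence the exponent [n - 2]. *)
  move=> db; rewrite ltNge; apply/negP => d1.
  have : sqm <= s%:R * (b j * r) by apply: le_trans db; rewrite ler_peMr // ltW.
  rewrite leNgt => /negP; apply.
  rewrite -(ltr_pM2l rn); apply: le_lt_trans Cr.
  have -> : r ^+ (n - 2) * (s%:R * (b j * r)) = s%:R * (b j * r ^+ (n - 2) * r) by ring.
  by rewrite ler_pM2l.
- move=> /(largeP _ _ n1 sC)[rp Gr Cr] Y0.
  have [j bj] := approx Gr; apply: (@intr_norm_lt1 R).
  (* With [Y = 0] the root drops out: [|X| <= s b_j <= s C / r ^+ (n - 1) < 1]. *)
  have := Xb j; rewrite Y0 mulr0 subr0 => /le_lt_trans; apply.
  apply: (@le_lt_trans _ _ (s%:R * C / r ^+ (n - 1))).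
    by rewrite -mulrA ler_pM2l.
  by rewrite ltr_pdivrMr ?exprn_gt0 // mul1r.
- move=> /(largeP _ _ n1 sCq)[rp Gr Cr] y20.
  have [j bj] := approx Gr; apply: (@intr_norm_lt1 R).
  have := xb j; rewrite y20 mulr0 subr0 => xbj.
  (* Here [sqm |x2|] is to be compared with [sqm] rather than 1, which accounts for the division by
     [sqm] in the threshold. *)
  rewrite -(ltr_pM2l sqm0) mulr1; apply: le_lt_trans xbj _.
  apply: (@le_lt_trans _ _ (s%:R * C / r ^+ (n - 1))).
    by rewrite -mulrA ler_pM2l.
  by rewrite ltr_pdivrMr ?exprn_gt0 // [ltRHS]mulrC -ltr_pdivrMr.
Qed.
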